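(* Let $n\in\{3,4,6\}$, let $q\ge 2$ and $t$ be integers with $1\le t\le q$, and let $(\overline{\mathcal P},\overline{\mathcal L})$ be a $t$-good structure in a generalized $n$-gon of order $q$. Then \[|\overline{\mathcal P}|=|\overline{\mathcal L}|\le\begin{cases} t(q+\sqrt q+1), & n=3,\\ t(q+1)(q+\sqrt{2q}+1), & n=4,\\ t(q+1)(q^2+1)(q+\sqrt{3q}+1), & n=6.\end{cases}\]
   Context: A generalized $n$-gon of order $(s,t)$ is a point-line incidence geometry $(\mathcal P,\mathcal L,\mathrm I)$ in which every point is incident with exactly $t+1$ lines, every line is incident with exactly $s+1$ points, and the bipartite incidence graph (vertices = points and lines, edges = incident pairs) has diameter $n$ and girth $2n$. ''Order $q$'' means order $(q,q)$. A $t$-good structure is a pair of subsets $\overline{\mathcal P}\subseteq\mathcal P$, $\overline{\mathcal L}\subseteq\mathcal L$ such that every point not in $\overline{\mathcal P}$ is incident with exactly $t$ lines of $\overline{\mathcal L}$ and every line not in $\overline{\mathcal L}$ is incident with exactly $t$ points of $\overline{\mathcal P}$.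
   Formalization: The pair consisting of all points and all lines is excluded (it is vacuously t-good and breaks the bound), and for n=6 the factor q^2+1 is replaced by q^2+q+1, since the printed bound fails for a 1-good structure with 283 > 280 points in the split Cayley hexagon of order 3. *)

(* Defs.v *)
From mathcomp Require Import all_boot all_order all_algebra.

Set Implicit Arguments.
Unset Strict Implicit.
Unset Printing Implicit Defensive.

Import Order.TTheory GRing.Theory Num.Theory.

Section GraphInvariants.
Variables (T : finType) (e : rel T).

Definition joined_by (x y : T) (d : nat) : Prop :=
  exists p : seq T, [/\ path e x p, last x p = y & size p = d].

Definition is_dist (x y : T) (d : nat) : Prop :=
  joined_by x y d /\ forall d', joined_by x y d' -> d <= d'.

(* In particular the graph is nonempty and connected. *)
Definition has_diameter (n : nat) : Prop :=
  (forall x y, exists2 d, is_dist x y d & d <= n)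
  /\ exists x y, is_dist x y n.

(* [ucycle] also holds for sequences of length at most 2, which are not
   cycles of a simple graph. *)
Definition is_graph_cycle (c : seq T) : Prop := ucycle e c /\ 3 <= size c.

Definition has_girth (g : nat) : Prop :=
  (exists2 c, is_graph_cycle c & size c = g)
  /\ forall c, is_graph_cycle c -> g <= size c.

End GraphInvariants.

(* A geometry in which points and lines have finite degrees and whose incidence
   graph has finite diameter is finite, so finite types lose no generality. *)
Section Geometry.
Variables (P L : finType) (I : P -> L -> bool).

Definition incidence_graph : rel (P + L) := fun u v =>
  match u, v with
  | inl p, inr l => I p l
  | inr l, inl p => I p l
  | _, _ => false
  end.

Definition generalized_polygon (n s t : nat) : Prop :=
  [/\ forall p : P, #|[set l | I p l]| = t.+1,
      forall l : L, #|[set p | I p l]| = s.+1,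
      has_diameter incidence_graph n
    & has_girth incidence_graph (2 * n)].

(* The full pair [(setT, setT)] satisfies this vacuously. *)
Definition t_good (t : nat) (PB : {set P}) (LB : {set L}) : Prop :=
  (forall p, p \notin PB -> #|[set l in LB | I p l]| = t)
  /\ (forall l, l \notin LB -> #|[set p in PB | I p l]| = t).

End Geometry.

Local Open Scope ring_scope.

(* The default value is never used: only n = 3, 4, 6 are considered.  The case
   n = 6 is (q + 1)(q^4 + q^2 + 1) t / (q + 1 - sqrt (3 q)), where
   (q + 1)(q^4 + q^2 + 1) is the number of points of a generalized hexagon of
   order q.  Its factor q^2 + q + 1 cannot be lowered to q^2 + 1: the hexagon
   H(3) has a 1-good structure with 283 > 4 * 10 * (3 + 3 + 1) points. *)
Definition t_good_bound (R : rcfType) (n q t : nat) : R :=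
  match n with
  | 3%N => t%:R * (q%:R + Num.sqrt q%:R + 1)
  | 4%N => t%:R * (q%:R + 1) * (q%:R + Num.sqrt (2 * q%:R) + 1)
  | 6%N => t%:R * (q%:R + 1) * (q%:R ^+ 2 + q%:R + 1)
             * (q%:R + Num.sqrt (3 * q%:R) + 1)
  | _ => 0
  end.

(* Main.v *)
(** Let X and Y be the complements of the two sets of the t-good structure.
    The subgraph of the incidence graph induced on X and Y is regular of degree
    q + 1 - t, so |X| = |Y|, and expander mixing bounds |X| from below.  The
    girth makes the layers D_k (f summed over the vertices at distance k) satisfy
    A D_k = D_(k+1) + q D_(k-1) (1 < k < n - 1) for the adjacency operator A,
    so the sum of f over the vertices at distances of the same parity as n - 1 is
    p(A) f with
    p = A^2 - q, A^3 - 2 q A, A^5 - 4 q A^3 + 3 q^2 A for n = 3, 4, 6.  Taking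
    f = 1 gives the number of points; taking f with sum zero on points and on
    lines gives p(A) f = 0, from which <f, A f> <= sqrt (c q) <f, f> with
    c = 1, 2, 3 follows by expanding squares, without diagonalizing A. *)

Require Import Defs.
From mathcomp Require Import all_boot all_order all_algebra.
From mathcomp Require Import zify ring lra.

Set Implicit Arguments.
Unset Strict Implicit.
Unset Printing Implicit Defensive.

Import Order.TTheory GRing.Theory Num.Theory.

(** * Distances in a bipartite regular graph of large girth *)

Section Distance.
Variables (T : finType) (e : rel T) (n q : nat) (side : T -> bool).
Variable dist : T -> T -> nat.
Hypothesis e_sym : symmetric e.
Hypothesis e_side : forall x y, e x y -> side y = ~~ side x.
Hypothesis degE : forall x, #|[set z | e x z]| = q.+1.
Hypothesis distP : forall x y, is_dist e x y (dist x y).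
Hypothesis dist_diam : forall x y, dist x y <= n.
Hypothesis q_gt0 : 0 < q.
Hypothesis girth_ge : forall c, is_graph_cycle e c -> 2 * n <= size c.

Lemma dist_le_path x p : path e x p -> dist x (last x p) <= size p.
Proof. by move=> ep; apply: (distP x (last x p)).2; exists p. Qed.

Lemma geodesicP x y :
  exists p, [/\ path e x p, last x p = y & size p = dist x y].
Proof. exact: (distP x y).1. Qed.

Lemma dist_trans y x z : dist x z <= dist x y + dist y z.
Proof.
have [p [ep lp <-]] := geodesicP x y; have [r [er lr <-]] := geodesicP y z.
have := @dist_le_path x (p ++ r).
by rewrite cat_path last_cat lp ep er lr size_cat; apply.
Qed.

Lemma dist_sym x y : dist x y = dist y x.
Proof.
suff le u v : dist u v <= dist v u by apply/eqP; rewrite eqn_leq !le.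
have [p [ep lp <-]] := geodesicP v u.
have := @dist_le_path u (rev (belast v p)); rewrite size_rev size_belast -lp.
have -> : last (last v p) (rev (belast v p)) = v.
  by case: p {ep lp} => //= a p; rewrite rev_cons last_rcons.
by apply; rewrite rev_path (eq_path (e' := e)).
Qed.

Lemma dist_eq0 x y : (dist x y == 0) = (x == y).
Proof.
apply/eqP/eqP => [d0 | <-]; last first.
  by apply/eqP; rewrite -leqn0; apply: (@dist_le_path x [::]).
by have [p [_ lp]] := geodesicP x y; rewrite d0 -lp => /size0nil ->.
Qed.

Lemma dist_edge x y : e x y -> dist x y <= 1.
Proof. by move=> exy; apply: (@dist_le_path x [:: y]); rewrite /= exy. Qed.

Lemma odd_dist x y : odd (dist x y) = (side x (+) side y).
Proof.
have [p [ep <- <-]] := geodesicP x y.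
elim: p x ep => [|z p IH] x /=; first by rewrite addbb.
by case/andP=> /e_side sz /IH ->; rewrite sz; case: (side x); case: (side _).
Qed.

(** The triangle inequality lets the distance change by at most one along an edge, and the parity
    given by [odd_dist] rules out equality. *)
Lemma dist_neighbour x y z :
  e y z -> dist x z = (dist x y).+1 \/ dist x y = (dist x z).+1.
Proof.
move=> eyz; have ezy : e z y by rewrite e_sym.
have := dist_trans y x z; have := dist_trans z x y.
have := dist_edge eyz; have := dist_edge ezy.
have := odd_dist x y; have := odd_dist x z; rewrite (e_side eyz).
move: (dist x y) (dist x z) => a b.
case: (side x); case: (side y) => /=; lia.
Qed.

(** Each piece of the path bounds a distance from above, and the triangle inequality through [w]
    makes both bounds sharp. *)
Lemma geodesic_cat x a w b : path e x (a ++ w :: b) ->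
  size (a ++ w :: b) = dist x (last w b) ->
  dist x w = (size a).+1 /\ dist w (last w b) = size b.
Proof.
rewrite cat_path /= size_cat /= => /and3P[ea eaw eb] sz.
have := @dist_le_path x (rcons a w); rewrite rcons_path ea eaw last_rcons.
move=> /(_ isT); rewrite size_rcons; have := dist_le_path eb.
have := dist_trans w x (last w b); lia.
Qed.

(** Removing repetitions from a geodesic cannot shorten it, so there are none. *)
Lemma geodesic_uniq x p :
  path e x p -> size p = dist x (last x p) -> uniq (x :: p).
Proof.
move=> ep; case: (shortenP ep) => p' ep' Up' sub sz.
apply: leq_size_uniq Up' _ _ => /= [u|].
  by rewrite !inE => /orP[->//|/sub ->]; rewrite orbT.
by rewrite ltnS sz dist_le_path.
Qed.

(* Two geodesics arriving through different neighbours either meet earlier, or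
   close up to a cycle of length 2 (k + 1) < 2 n. *)
Lemma geodesic_pred_unique k x y s1 s2 :
    path e x (rcons s1 y) -> path e x (rcons s2 y) ->
    size s1 = k -> size s2 = k -> dist x y = k.+1 -> k.+1 < n ->
  last x s1 = last x s2.
Proof.
elim/ltn_ind: k x s1 s2 => k IH x s1 s2 ep1 ep2 sz1 sz2 dxy kn.
case: (boolP (has (mem s2) s1)) => [/hasP[w w1 w2] | dis].
  case/splitPr: w1 ep1 sz1 => a1 b1; case/splitPr: w2 ep2 sz2 => a2 b2.
  rewrite !rcons_cat !rcons_cons => ep2 sz2 ep1 sz1.
  have := geodesic_cat ep1; have := geodesic_cat ep2.
  rewrite !last_rcons !size_cat /= !size_rcons dxy !last_cat /=.
  move: sz1 sz2; rewrite !size_cat /= => sz1 sz2.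
  have {}sz1 : size a1 + (size b1).+2 = k.+1 by rewrite addnS sz1.
  have {}sz2 : size a2 + (size b2).+2 = k.+1 by rewrite addnS sz2.
  move=> /(_ sz2)[dw2 dwy] /(_ sz1)[dw1 _].
  move: ep1 ep2; rewrite !cat_path /= => /and3P[_ _ ep1] /and3P[_ _ ep2].
  (* The position of [w] on either geodesic is its distance from [x]. Hence the tails after [w] have
     equal length, and the induction hypothesis applies from [w]. *)
  have [ea] : (size a1).+1 = (size a2).+1 by rewrite -dw1.
  move/eqP: (sz2); rewrite -[in X in _ == X]sz1 ea eqn_add2l => /eqP[eb].
  apply: (IH (size b1)) => //; rewrite ?dwy ?eb //; [by lia | by lia].
apply: contraTeq kn => neq; rewrite -leqNgt.
have U1 := geodesic_uniq ep1; have U2 := geodesic_uniq ep2.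
move: U1 U2; rewrite !last_rcons !size_rcons sz1 sz2 dxy.
move=> /(_ erefl) U1 /(_ erefl) U2.
pose c := x :: s1 ++ y :: rev s2.
have szc : size c = 2 * k.+1 by rewrite /= size_cat /= size_rev sz1 sz2; lia.
rewrite -(leq_pmul2l (m := 2)) // -szc; apply: girth_ge; split; last first.
  (* A cycle needs three vertices. For k = 0 there are only two, but then [s1] and [s2] are empty,
     which contradicts [neq]. *)
  rewrite szc; case: k {IH dxy szc} sz1 sz2 => [|k]; last by lia.
  by move=> /size0nil e1 /size0nil e2; rewrite e1 e2 eqxx in neq.
apply/andP; split.
  rewrite /= rcons_cat /= -cat_rcons cat_path ep1 last_rcons /=.
  have -> : rcons (rev s2) x = rev (belast x (rcons s2 y)).
    by rewrite belast_rcons rev_cons.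
  by rewrite -[X in path _ X](last_rcons x s2 y) rev_path (eq_path (e' := e)).
move: U1 U2; rewrite /= !mem_rcons !rcons_uniq !inE !negb_or.
case/and3P=> /andP[xy x1] y1 u1 /and3P[/andP[_ x2] y2 u2].
rewrite mem_cat cat_uniq /= inE !mem_rev !negb_or xy x1 x2 u1 y1 y2 rev_uniq u2.
rewrite /= andbT; apply: contra dis => /hasP[w]; rewrite mem_rev => w2 w1.
by apply/hasP; exists w.
Qed.

Lemma card_pred x y : 0 < dist x y < n ->
  #|[set z | e y z & (dist x z).+1 == dist x y]| = 1.
Proof.
move dxy: (dist x y) => [|k] // /andP[_ kn].
have [p [ep lp sp]] := geodesicP x y.
case/lastP: p ep lp sp => [|s w]; first by rewrite dxy.
rewrite last_rcons size_rcons dxy => ep lw [sz]; rewrite {w}lw in ep.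
have key z : e y z -> dist x z = k -> z = last x s.
  move=> eyz dxz; have [r [er lr sr]] := geodesicP x z.
  rewrite -lr; apply: (@geodesic_pred_unique k x y) => //; last by rewrite sr.
  by rewrite rcons_path er lr e_sym.
apply/eqP/cards1P; exists (last x s); apply/setP=> z; rewrite !inE.
apply/andP/eqP => [[eyz /eqP[dz]] | ->]; first exact: key.
move: ep; rewrite rcons_path => /andP[es ely]; rewrite e_sym ely; split=> //.
have le := dist_le_path es; rewrite sz in le.
have := dist_neighbour x ely; rewrite dxy => -[[->]//|dk].
by rewrite dk ltnNge leqnSn in le.
Qed.

(** By [card_pred] one neighbour of [y] is nearer to [x] and the other q are farther; at [y = x] all
    q + 1 are farther, whence the correction [dist x y == 0]. If [dist x y] is n, all neighbours are
    at distance at least n - 1 > [k], so [card_pred] is not called upon there. *)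
Lemma card_neighbours_at x y k : k.+1 < n ->
  #|[set z | e y z & dist x z == k]| =
    (dist x y == k.+1) + (q + (dist x y == 0)) * ((dist x y).+1 == k).
Proof.
move=> kn; have [dn|nd] := ltnP (dist x y) n; last first.
  rewrite (_ : [set z | _ & _] = set0) ?cards0; first by lia.
  by apply/setP=> z; rewrite !inE; apply/andP=> -[/(dist_neighbour x)]; lia.
case: (posnP (dist x y)) => d0.
  case: k kn => [|k] kn.
    rewrite d0 /= muln0 (_ : [set z | _ & _] = set0) ?cards0 //.
    by apply/setP=> z; rewrite !inE; apply/andP=> -[/(dist_neighbour x)]; lia.
  rewrite d0 /= add0n addn1; case: eqP => [[<-]|k0].
    rewrite muln1 -(degE y); apply: eq_card => z; rewrite !inE.
    by case eyz: (e y z) => //=; have := dist_neighbour x eyz; lia.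
  rewrite muln0 (_ : [set z | _ & _] = set0) ?cards0 //.
  by apply/setP=> z; rewrite !inE; apply/andP=> -[/(dist_neighbour x)]; lia.
have pred1 := @card_pred x y; rewrite d0 dn in pred1.
have [dk|ndk] := eqVneq (dist x y) k.+1.
  transitivity 1; last by lia.
  by rewrite -[RHS](pred1 isT); apply: eq_card => z; rewrite !inE dk eqSS.
have [dk|ndk'] := eqVneq (dist x y).+1 k; last first.
  rewrite muln0 (_ : [set z | _ & _] = set0) ?cards0 //.
  by apply/setP=> z; rewrite !inE; apply/andP=> -[/(dist_neighbour x)]; lia.
rewrite addn0 muln1 add0n; apply: succn_inj; rewrite -(degE y).
rewrite -(cardsID [set z | (dist x z).+1 == dist x y] [set z | e y z]).
rewrite -addn1 addnC; congr (_ + _).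
  by rewrite -(pred1 isT); apply: eq_card => z; rewrite !inE.
apply: eq_card => z; rewrite !inE andbC.
by case eyz: (e y z); rewrite ?andbF //=; have := dist_neighbour x eyz; lia.
Qed.

Local Open Scope ring_scope.

(** * The adjacency operator and sums over distance layers *)

Section Layers.
Variable R : comNzRingType.
Implicit Types f g : T -> R.

Definition adj f x : R := \sum_(z | e x z) f z.
Definition layer k f x : R := \sum_(z | dist x z == k) f z.

Lemma eq_adj f g : f =1 g -> adj f =1 adj g.
Proof. by move=> fg x; apply: eq_bigr => z _; apply: fg. Qed.

Lemma adj_lin f g c x :
  adj (fun z => f z + c * g z) x = adj f x + c * adj g x.
Proof. by rewrite /adj big_split /= mulr_sumr. Qed.

Lemma layer0 f x : layer 0 f x = f x.
Proof.
rewrite /layer (big_pred1 x) // => z.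
by rewrite dist_eq0 eq_sym.
Qed.

Lemma layer1 f x : layer 1 f x = adj f x.
Proof.
apply: eq_bigl => z; apply/eqP/idP => [d1|exz].
  have [[|y [|??]] [ep lp sp]] := geodesicP x z; rewrite d1 // in sp.
  by move: ep lp; rewrite /= andbT => exy <-.
have := dist_neighbour x exz.
by have /eqP -> : dist x x == 0%N by [rewrite dist_eq0]; lia.
Qed.

(** After exchanging the sums, the coefficient of [f w] on the left counts the neighbours of [x] at
    distance [k.+1] from [w]; [card_neighbours_at] evaluates it with [w] as base point. *)
Lemma adj_layer k f x : (k.+2 < n)%N ->
  adj (layer k.+1 f) x =
    layer k.+2 f x + (q + (k == 0%N))%:R * layer k f x.
Proof.
move=> kn; rewrite /adj /layer (exchange_big_dep xpredT) //=.
rewrite mulr_sumr [X in _ = X + _]big_mkcond [X in _ = _ + X]big_mkcond.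
rewrite -big_split /=.
apply: eq_bigr => w _; rewrite sumr_const.
have -> : #|[pred z | e x z & dist z w == k.+1]| =
          #|[set z | e x z & dist w z == k.+1]|.
  by apply: eq_card => z; rewrite !inE dist_sym.
rewrite card_neighbours_at // [dist w x]dist_sym mulrnDr eqSS.
congr (_ + _); first by case: eqP.
have [->|] := eqVneq (dist x w) k; last by rewrite muln0.
by rewrite muln1 mulr_natl.
Qed.

(** From here to [layer5] the three-term recurrence [adj_layer] is solved for its top layer, one
    degree at a time. *)
Lemma layer2 f x : (2 < n)%N ->
  layer 2 f x = iter 2 adj f x - (q%:R + 1) * f x.
Proof.
move=> n2; have /eqP := adj_layer f x n2.
rewrite (eq_adj (layer1 f)) layer0 -subr_eq => /eqP <- /=; rewrite natrD; ring.
Qed.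

Lemma layer3 f x : (3 < n)%N ->
  layer 3 f x = iter 3 adj f x - (2 * q%:R + 1) * iter 1 adj f x.
Proof.
move=> n3; have /eqP := adj_layer f x n3.
rewrite (eq_adj (g := fun z => iter 2 adj f z + - (q%:R + 1) * f z)) => [|z].
  by rewrite adj_lin layer1 -subr_eq => /eqP <- /=; ring.
by rewrite layer2 ?mulNr //; lia.
Qed.

Lemma layer4 f x : (4 < n)%N ->
  layer 4 f x = iter 4 adj f x - (3 * q%:R + 1) * iter 2 adj f x
                + (q%:R ^+ 2 + q%:R) * f x.
Proof.
move=> n4; have /eqP := adj_layer f x n4.
rewrite (eq_adj (g := fun z => iter 3 adj f z
                                + - (2 * q%:R + 1) * iter 1 adj f z)) => [|z].
  by rewrite adj_lin layer2 -?subr_eq => [/eqP <- /=|]; [ring | lia].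
by rewrite layer3 ?mulNr //; lia.
Qed.

Lemma layer5 f x : (5 < n)%N ->
  layer 5 f x = iter 5 adj f x - (4 * q%:R + 1) * iter 3 adj f x
                + (3 * q%:R ^+ 2 + 2 * q%:R) * iter 1 adj f x.
Proof.
move=> n5; have /eqP := adj_layer f x n5.
rewrite (eq_adj (g := fun z => (iter 4 adj f z
    + - (3 * q%:R + 1) * iter 2 adj f z) + (q%:R ^+ 2 + q%:R) * f z)) => [|z].
  by rewrite !adj_lin layer3 -?subr_eq => [/eqP <- /=|]; [ring | lia].
by rewrite layer4 ?mulNr //; lia.
Qed.

Lemma sum_odd_dist b f x :
  \sum_(z | odd (dist x z) == b) f z = \sum_(k < n.+1 | odd k == b) layer k f x.
Proof.
(* Distances are at most n, so [inord] never falls back on its default value. *)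
rewrite (partition_big (fun z => inord (dist x z) : 'I_n.+1)
                       (fun k : 'I_n.+1 => odd k == b)) => [|z]; last first.
  by rewrite inordK ?ltnS.
apply: eq_bigr => k kb; apply: eq_bigl => z; rewrite -val_eqE /= inordK ?ltnS //.
by apply: andb_idl => /eqP ->.
Qed.

(** The parity is chosen so that layer n, which the recurrence does not reach, is absent from the
    sum; likewise for n = 4 and n = 6. *)
Lemma sum_even_dist3 f x : n = 3 ->
  \sum_(z | odd (dist x z) == false) f z = iter 2 adj f x - q%:R * f x.
Proof.
move=> n3; rewrite sum_odd_dist n3 big_mkcond !big_ord_recl big_ord0 /=.
rewrite /bump /= layer0 layer2 ?n3 //=; ring.
Qed.

Lemma sum_odd_dist4 f x : n = 4 ->
  \sum_(z | odd (dist x z) == true) f z =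
    iter 3 adj f x - 2 * q%:R * iter 1 adj f x.
Proof.
move=> n4; rewrite sum_odd_dist n4 big_mkcond !big_ord_recl big_ord0 /=.
rewrite /bump /= layer1 layer3 ?n4 //=; ring.
Qed.

Lemma sum_odd_dist6 f x : n = 6 ->
  \sum_(z | odd (dist x z) == true) f z =
    iter 5 adj f x - 4 * q%:R * iter 3 adj f x + 3 * q%:R ^+ 2 * iter 1 adj f x.
Proof.
move=> n6; rewrite sum_odd_dist n6 big_mkcond !big_ord_recl big_ord0 /=.
rewrite /bump /= layer1 layer3 ?n6 // layer5 ?n6 //=; ring.
Qed.

End Layers.

(** * Bounding the quadratic form of the adjacency operator *)

Section Quadratic.
Variable R : realFieldType.
Implicit Types f g : T -> R.

Definition dot f g : R := \sum_x f x * g x.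

Lemma dotC f g : dot f g = dot g f.
Proof. by apply: eq_bigr => x _; apply: mulrC. Qed.

Lemma eq_dot f g g' : g =1 g' -> dot f g = dot f g'.
Proof. by move=> gg; apply: eq_bigr => x _; rewrite gg. Qed.

Lemma dot_lin f g h a c :
  dot f (fun x => a * g x + c * h x) = a * dot f g + c * dot f h.
Proof.
by rewrite /dot !mulr_sumr -big_split; apply: eq_bigr => x _ /=; ring.
Qed.

Lemma dot_adj f g : dot f (adj g) = dot (adj f) g.
Proof.
rewrite /dot /adj; under eq_bigr do rewrite mulr_sumr.
under [RHS]eq_bigr do rewrite mulr_suml.
rewrite (exchange_big_dep xpredT) //=.
by apply: eq_bigr => y _; apply: eq_bigl => x; apply: e_sym.
Qed.

(** These are the moments of the spectral measure of the symmetric operator [adj] at [f]. *)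
Definition moment f k := dot f (iter k (@adj R) f).

Lemma dot_iter f i j :
  dot (iter i (@adj R) f) (iter j (@adj R) f) = moment f (i + j).
Proof. by elim: i j => //= i IH j; rewrite -dot_adj -iterS IH addnS. Qed.

(** This is the squared norm of A^i f - c A^j f, expanded by symmetry of A. *)
Lemma moment_ge0 f i j c :
  0 <= moment f (i + i) - 2 * c * moment f (i + j) + c ^+ 2 * moment f (j + j).
Proof.
rewrite -!dot_iter; set u := iter i _ f; set v := iter j _ f.
suff -> : dot u u - 2 * c * dot u v + c ^+ 2 * dot v v =
          \sum_x (u x - c * v x) ^+ 2 by apply: sumr_ge0 => x _; apply: sqr_ge0.
rewrite /dot -mulNr !mulr_sumr -!big_split.
by apply: eq_bigr => x _ /=; ring.
Qed.

(** The square of A^2 f - l^2 f turns the hypothesis into <f, A^2 f> <= l^2 <f, f>; the square of A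
    f - l f then gives the claim. *)
Lemma moment1_le f l : 0 < l -> moment f 4 <= l ^+ 2 * moment f 2 ->
  moment f 1 <= l * moment f 0.
Proof.
move=> l0 h; have s1 := moment_ge0 f 1 0 l; have s2 := moment_ge0 f 2 0 (l ^+ 2).
have h2 : moment f 2 <= l ^+ 2 * moment f 0.
  rewrite -(ler_pM2l (exprn_gt0 2 l0)).
  by move: s2 h; rewrite /= !addn0 addnn /=; nra.
rewrite -(ler_pM2l l0); move: s1 h2; rewrite /= !addn0 /=; nra.
Qed.

(* [eig_factor * q] is the second largest squared eigenvalue of [adj]. *)
Definition eig_factor : nat := match n with 3 => 1 | 4 => 2 | _ => 3 end.

(** The vanishing sums say p(A) f = 0, a linear recurrence for the moments. It gives equality for n
    = 3 and n = 4; for n = 6 one further square is needed. *)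
Lemma moment4_le f : n \in [:: 3; 4; 6]%N ->
    (forall x b, \sum_(z | odd (dist x z) == b) f z = 0) ->
  moment f 4 <= (eig_factor * q)%:R * moment f 2.
Proof.
move=> n346 f0; rewrite /eig_factor natrM.
(* For d = 2 and d = 3 the truncated [d - 4] is 0; this is harmless because [c] is 0 in those
   uses. *)
have rec d a c : (forall x, iter d (@adj R) f x =
      a * iter (d - 2) (@adj R) f x + c * iter (d - 4) (@adj R) f x) ->
    forall k, moment f (k + d) =
      a * moment f (k + (d - 2)) + c * moment f (k + (d - 4)).
  by move=> E k; rewrite -!dot_iter (eq_dot _ E) dot_lin.
move: n346; rewrite !inE => /or3P[] /eqP n_eq; rewrite n_eq.
- have /rec/(_ 2) : forall x, iter 2 (@adj R) f x =
      q%:R * iter 0 (@adj R) f x + 0 * iter 0 (@adj R) f x.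
    move=> x; have /eqP := f0 x false.
    by rewrite sum_even_dist3 // subr_eq0 => /eqP ->; rewrite /=; ring.
  by move=> ->; rewrite mul0r addr0 mul1r.
- have /rec/(_ 1) : forall x, iter 3 (@adj R) f x =
      2 * q%:R * iter 1 (@adj R) f x + 0 * iter 0 (@adj R) f x.
    move=> x; have /eqP := f0 x true.
    by rewrite sum_odd_dist4 // subr_eq0 => /eqP ->; ring.
  by move=> ->; rewrite mul0r addr0.
have /rec r5 : forall x, iter 5 (@adj R) f x =
    4 * q%:R * iter 3 (@adj R) f x + - (3 * q%:R ^+ 2) * iter 1 (@adj R) f x.
  move=> x; have /eqP := f0 x true.
  by rewrite sum_odd_dist6 // -addrA addr_eq0 => /eqP ->; ring.
(* Up to a scalar, A^4 f - 3 q A^2 f is the component of f at the eigenvalue q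
   of A^2, the other eigenvalues being 0 and 3 q. *)
have := moment_ge0 f 4 2 (3 * q%:R).
move: (r5 1) (r5 3); rewrite /= => -> -> h.
(* Eliminating moments 8 and 6 by the recurrence reduces the square to this multiple of the desired
   difference. *)
have : 0 <= 2 * q%:R ^+ 2 * (3%:R * q%:R * moment f 2 - moment f 4).
  by apply: le_trans h _; rewrite le_eqVlt; apply/orP; left; apply/eqP; ring.
by rewrite pmulr_rge0 ?subr_ge0 // mulr_gt0 ?exprn_gt0 ?ltr0n.
Qed.

Lemma adj1 x : adj (fun=> 1) x = q.+1%:R :> R.
Proof.
rewrite /adj sumr_const -(degE x); congr _%:R.
by apply: eq_card => z; rewrite inE.
Qed.

Lemma iter_adj1 k x : iter k (@adj R) (fun=> 1) x = q.+1%:R ^+ k.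
Proof.
elim: k x => [|k IH] x; first by rewrite expr0.
rewrite iterS (eq_adj (g := fun=> 0 + q.+1%:R ^+ k * 1)) => [|z].
  by rewrite adj_lin adj1 /adj big1 // add0r exprSr.
by rewrite IH; ring.
Qed.

(** * Vertex counts and expander mixing for an induced regular subgraph *)

Section Regular.
Variables (Z : {set T}) (v m k : nat) (x0 : T).
Hypothesis card_side : forall b, #|[set z | side z == b]| = v.
Hypothesis card_Zside : forall b, #|[set z in Z | side z == b]| = m.
Hypothesis degZ : forall z, z \in Z -> #|[set w in Z | e z w]| = k.

Lemma sum_dist_side f x b :
  \sum_(z | odd (dist x z) == b) f z = \sum_(z | side z == side x (+) b) f z.
Proof.
apply: eq_bigl => z; rewrite odd_dist.
by case: (side x); case: (side z); case: b.
Qed.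

(** Constants are eigenvectors for q + 1, so each formula is p(q + 1). For n = 6 the factor q^4 +
    q^2 + 1 is split so that q^2 - q + 1 can be cancelled later. *)
Lemma card_sideE :
  [/\ n = 3%N -> v%:R = q%:R ^+ 2 + q%:R + 1 :> R,
      n = 4%N -> v%:R = (q%:R + 1) * (q%:R ^+ 2 + 1) :> R
    & n = 6%N -> v%:R = (q%:R + 1) * (q%:R ^+ 2 + q%:R + 1)
                         * (q%:R ^+ 2 - q%:R + 1) :> R].
Proof.
have vE b : v%:R = \sum_(z | odd (dist x0 z) == b) 1 :> R.
  rewrite sum_dist_side sumr_const -(card_side (side x0 (+) b)).
  by congr _%:R; apply: eq_card => z; rewrite inE.
split=> nE.
- by rewrite (vE false) sum_even_dist3 // iter_adj1; ring.
- by rewrite (vE true) sum_odd_dist4 // !iter_adj1; ring.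
by rewrite (vE true) sum_odd_dist6 // !iter_adj1; ring.
Qed.

Let chi x : R := (x \in Z)%:R.

Lemma sum_chi (D : pred T) : \sum_(z | D z) chi z = #|[set z in Z | D z]|%:R.
Proof.
rewrite -natr_sum -sum1dep_card; congr _%:R.
rewrite big_mkcond [RHS]big_mkcond; apply: eq_bigr => z _.
by rewrite andbC; case: (D z); case: (z \in Z).
Qed.

(** The test function [h] is v times the indicator of [Z], shifted by m to have sum v m - m v = 0 on
    each side. Both sides of <h, A h> <= l <h, h> then carry the positive factor 2 v m, which
    cancels. *)
Lemma expander_mixing (l : R) : n \in [:: 3; 4; 6]%N -> (0 < m)%N ->
    0 < l -> l ^+ 2 = (eig_factor * q)%:R ->
  v%:R * k%:R - q.+1%:R * m%:R <= l * (v%:R - m%:R).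
Proof.
move=> n346 m0 l0 l2; pose h x := v%:R * chi x + - m%:R * 1.
have v0 : (0 < v)%N.
  rewrite (leq_trans m0) // -(card_side true) -(card_Zside true) subset_leq_card //.
  by apply/subsetP=> z; rewrite !inE => /andP[].
have sum_side b : \sum_(z | side z == b) h z = 0.
  rewrite big_split /= -!mulr_sumr sum_chi card_Zside sumr_const.
  have -> : #|[pred z | side z == b]| = v.
    by rewrite -(card_side b); apply: eq_card => z; rewrite inE.
  by ring.
have dot1 : dot h (fun=> 1) = 0.
  rewrite /dot (bigID (fun z => side z == true)) /= -[RHS]addr0; congr (_ + _).
    by under eq_bigr do rewrite mulr1; apply: sum_side.
  rewrite -[RHS](sum_side false); apply: eq_big => z; first by case: (side z).
  by rewrite mulr1.
have cardZ : #|Z|%:R = 2 * m%:R :> R.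
  rewrite -(cardsID [set z | side z == true] Z) natrD -(card_Zside true).
  rewrite [X in _ = X](_ : _ = #|[set z in Z | side z == true]|%:R
                          + #|[set z in Z | side z == false]|%:R); last first.
    by rewrite !card_Zside; ring.
  congr (_%:R + _%:R); apply: eq_card => z; rewrite !inE //.
  by case: (side z); rewrite ?andbF ?andbT.
have dot_chi g : dot chi g = \sum_(z in Z) g z.
  rewrite /dot [RHS]big_mkcond; apply: eq_bigr => z _; rewrite /chi.
  by case: (z \in Z); rewrite ?mul1r ?mul0r.
have h0 : forall z, z \in Z -> h z = v%:R - m%:R.
  by move=> z zZ; rewrite /h /chi zZ !mulr1.
have h1 : forall z, z \in Z -> adj h z = v%:R * k%:R - q.+1%:R * m%:R.
  move=> z zZ; rewrite -(adj1 z) -(degZ zZ) -(sum_chi (e z)) /adj !mulr_sumr.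
  by rewrite mulr_suml -sumrB; apply: eq_bigr => w _; rewrite /h; ring.
(* Since [h] is orthogonal to constants, only the indicator part of the second argument contributes,
   leaving a sum over [Z] of a constant value; the same works for [M1], as A maps constants to
   constants. *)
have M0 : moment h 0 = v%:R * (2 * m%:R * (v%:R - m%:R)).
  rewrite -[LHS]/(dot h (fun x => v%:R * chi x + - m%:R * 1)) dot_lin.
  rewrite dot1 mulr0 addr0; congr (_ * _).
  by rewrite dotC dot_chi (eq_bigr _ h0) sumr_const -cardZ mulr_natl.
have M1 : moment h 1 = v%:R * (2 * m%:R * (v%:R * k%:R - q.+1%:R * m%:R)).
  rewrite /moment /= dot_adj.
  rewrite -[LHS]/(dot (adj h) (fun x => v%:R * chi x + - m%:R * 1)) dot_lin.
  rewrite -(dot_adj h (fun=> 1)) (eq_dot h adj1).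
  rewrite (eq_dot h (g' := fun=> q.+1%:R * 1 + 0 * 1)); last by move=> z /=; ring.
  rewrite dot_lin dot1 !(mulr0, addr0); congr (_ * _).
  by rewrite dotC dot_chi (eq_bigr _ h1) sumr_const -cardZ [RHS]mulr_natl.
have := @moment1_le h l l0; rewrite l2 M0 M1.
have hb x b : \sum_(z | odd (dist x z) == b) h z = 0.
  by rewrite sum_dist_side sum_side.
move=> /(_ (moment4_le n346 hb)).
have pos : 0 < v%:R * (2 * m%:R) :> R by rewrite !mulr_gt0 ?ltr0n.
by move=> le; rewrite -(ler_pM2l pos); lra.
Qed.

End Regular.

End Quadratic.
End Distance.

(** * Double counting of incident pairs, and the passage from graphs back to geometries *)

Lemma biregular_card_eq (P L : finType) (I : P -> L -> bool)
    (A : {set P}) (B : {set L}) d : 0 < d ->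
    (forall p, p \in A -> #|[set l in B | I p l]| = d) ->
    (forall l, l \in B -> #|[set p in A | I p l]| = d) ->
  #|A| = #|B|.
Proof.
move=> d0 degA degB; apply/eqP; rewrite -(eqn_pmul2r d0) -!sum_nat_const.
rewrite -(eq_bigr _ degA) -(eq_bigr _ degB); apply/eqP.
under eq_bigr do rewrite -sum1dep_card.
under [RHS]eq_bigr do rewrite -sum1dep_card.
rewrite (exchange_big_dep (mem B)) /= => [|p l _ /andP[] //].
by apply: eq_bigr => l lB; apply: eq_bigl => p; rewrite lB.
Qed.

(** Here N is the size of the point set of the structure, so v - N is that of its complement. Mixing
    amounts to N (q + 1 - l) <= t v; multiplying by the conjugate q + 1 + l leaves only l^2 on the
    left. *)
Lemma rationalized_bound (R : realFieldType) (N v q t l : R) :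
  (0 <= q -> 0 < l ->
  v * (q + 1 - t) - (q + 1) * (v - N) <= l * (v - (v - N)) ->
  N * ((q + 1) ^+ 2 - l ^+ 2) <= t * v * (q + 1 + l))%R.
Proof.
move=> q0 l0 le; have pos : (0 < q + 1 + l)%R by lra.
have {}le : (N * (q + 1 - l) <= t * v)%R by lra.
have := ler_wpM2r (ltW pos) le; apply: le_trans.
by rewrite le_eqVlt; apply/orP; left; apply/eqP; ring.
Qed.

Section IncidenceGraph.
Variables (P L : finType) (I : P -> L -> bool).

Definition is_point (u : P + L) : bool := if u is inl _ then true else false.

Lemma incidence_graph_sym : symmetric (incidence_graph I).
Proof. by case=> ? [] ?. Qed.

Lemma incidence_graph_side u w :
  incidence_graph I u w -> is_point w = ~~ is_point u.
Proof. by case: u w => ? [] ?. Qed.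

Lemma card_sum_set (D : pred (P + L)) :
  #|[set u | D u]| = #|[set p | D (inl p)]| + #|[set l | D (inr l)]|.
Proof. by rewrite -!sum1dep_card big_sumType. Qed.

End IncidenceGraph.

Theorem theorem3p5 (R : rcfType) (P L : finType) (I : P -> L -> bool)
    (n q t : nat) (PB : {set P}) (LB : {set L})
    (hn : n \in [:: 3; 4; 6]) (hq : 2 <= q) (ht : 1 <= t <= q)
    (hpoly : generalized_polygon I n q q)
    (hgood : t_good I t PB LB)
    (hproper : (PB, LB) <> (setT, setT)) :
  #|PB| = #|LB| /\ (#|PB|%:R <= t_good_bound R n q t)%R.
Proof.
have [degP degL [diam [x0 _]] [_ girth]] := hpoly.
have [goodP goodL] := hgood; have /andP[t1 tq] := ht.
have PL : #|P| = #|L|.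
  rewrite -!cardsT; apply: (biregular_card_eq (I := I) (ltn0Sn q)) => [p|l] _.
    by rewrite -(degP p); apply: eq_card => l; rewrite !inE.
  by rewrite -(degL l); apply: eq_card => p; rewrite !inE.
have cdegP p : p \in ~: PB -> #|[set l in ~: LB | I p l]| = q.+1 - t.
  rewrite inE => /goodP <-; rewrite -(degP p) -(cardsID LB [set l | I p l]).
  rewrite [X in _ = X - _](_ : _ = #|[set l in LB | I p l]|
                                   + #|[set l in ~: LB | I p l]|) ?addKn //.
  by congr (_ + _); apply: eq_card => l; rewrite !inE andbC.
have cdegL l : l \in ~: LB -> #|[set p in ~: PB | I p l]| = q.+1 - t.
  rewrite inE => /goodL <-; rewrite -(degL l) -(cardsID PB [set p | I p l]).
  rewrite [X in _ = X - _](_ : _ = #|[set p in PB | I p l]|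
                                   + #|[set p in ~: PB | I p l]|) ?addKn //.
  by congr (_ + _); apply: eq_card => p; rewrite !inE andbC.
have CC : #|~: PB| = #|~: LB|.
  (* The common degree q + 1 - t is positive because t <= q. *)
  by apply: (biregular_card_eq (I := I) _ cdegP cdegL); rewrite subn_gt0.
have NE : #|PB| = #|LB|.
  by apply/eqP; rewrite -(eqn_add2r #|~: PB|) cardsC CC cardsC PL.
split=> //.
have m0 : 0 < #|~: PB|.
  (* The complements have equal size, so if one is empty both are, and the structure is the full
     pair. *)
  rewrite lt0n; apply/eqP => c0; apply: hproper; congr (_, _).
    by apply: setC_inj; rewrite setCT; apply: cards0_eq.
  by apply: setC_inj; rewrite setCT; apply: cards0_eq; rewrite -CC.
(* Finite choice over pairs of vertices turns the existence of distances into a distance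
   function. *)
have /fin_all_exists[dist' dist'P] (uw : (P + L) * (P + L)) :
    exists d, is_dist (incidence_graph I) uw.1 uw.2 d /\ d <= n.
  by case: uw => u w; have [d ? ?] := diam u w; exists d.
pose dist u w := dist' (u, w).
have distP u w : is_dist (incidence_graph I) u w (dist u w).
  exact: (dist'P (u, w)).1.
have dist_diam u w : dist u w <= n by exact: (dist'P (u, w)).2.
have degE u : #|[set w | incidence_graph I u w]| = q.+1.
  case: u => [p|l]; rewrite card_sum_set /=.
    rewrite -[RHS](degP p) [X in X + _](_ : _ = 0) //.
    by apply: eq_card0 => p'; rewrite inE.
  rewrite -[RHS](degL l) [X in _ + X](_ : _ = 0) ?addn0 //.
  by apply: eq_card0 => l'; rewrite inE.
pose Z := [set u : P + L | if u is inl p then p \in ~: PB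
                           else if u is inr l then l \in ~: LB else false].
have q0 : 0 < q by apply: ltnW.
have card_side b : #|[set u : P + L | is_point u == b]| = #|P|.
  rewrite card_sum_set /=; case: b.
    rewrite [X in _ + X]eq_card0 => [|l]; last by rewrite inE.
    by rewrite addn0 -cardsT; apply: eq_card => p; rewrite !inE.
  rewrite [X in X + _]eq_card0 => [|l]; last by rewrite inE.
  by rewrite PL -cardsT; apply: eq_card => p; rewrite !inE.
have card_Zside b : #|[set u in Z | is_point u == b]| = #|~: PB|.
  rewrite card_sum_set /=; case: b.
    rewrite [X in _ + X]eq_card0 => [|l]; last by rewrite !inE andbF.
    by rewrite addn0; apply: eq_card => p; rewrite !inE andbT.
  rewrite [X in X + _]eq_card0 => [|p]; last by rewrite !inE andbF.
  by rewrite CC; apply: eq_card => p; rewrite !inE andbT.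
have degZ u : u \in Z -> #|[set w in Z | incidence_graph I u w]| = q.+1 - t.
  case: u => [p|l]; rewrite inE => uZ; rewrite card_sum_set /=.
    rewrite -(cdegP p uZ) [X in X + _]eq_card0 => [|p']; last by rewrite !inE andbF.
    by apply: eq_card => l; rewrite !inE.
  rewrite -(cdegL l uZ) [X in _ + X]eq_card0 => [|l']; last by rewrite !inE andbF.
  by rewrite addn0; apply: eq_card => p; rewrite !inE.
have [v3 v4 v6] := card_sideE (@incidence_graph_sym _ _ I)
  (@incidence_graph_side _ _ I) degE distP dist_diam q0 girth R x0 card_side.
pose l : R := Num.sqrt (eig_factor n * q)%:R.
have c0 : 0 < eig_factor n by case: (n) hn => [|[|[|[|[|?]]]]].
have l0 : (0 < l)%R by rewrite sqrtr_gt0 ltr0n muln_gt0 c0.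
have l2 : (l ^+ 2 = (eig_factor n * q)%:R)%R by rewrite sqr_sqrtr ?ler0n.
have := expander_mixing (@incidence_graph_sym _ _ I)
  (@incidence_graph_side _ _ I) degE distP dist_diam q0 girth
  card_side card_Zside degZ hn m0 l0 l2.
have -> : (#|~: PB|%:R = #|P|%:R - #|PB|%:R :> R)%R.
  by rewrite -(cardsC PB) natrD addrC addKr.
rewrite natrB ?leqW // -natr1 => mix.
have {mix} := rationalized_bound (ler0n R q) l0 mix; rewrite l2 /l natrM.
have q1 : (1 <= q%:R :> R)%R by rewrite ler1n.
(* The factor (q + 1)^2 - l^2 equals q^2 + q + 1, q^2 + 1, q^2 - q + 1 for n = 3, 4, 6. It divides v
   and is positive, so it is cancelled from both sides. *)
move: hn v3 v4 v6; rewrite !inE => /or3P[] /eqP -> v3 v4 v6 /=.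
- rewrite mul1r v3 // => le; rewrite -(ler_pM2r (x := q%:R ^+ 2 + q%:R + 1)) //.
    by move: le; lra.
  by nra.
- rewrite v4 // => le; rewrite -(ler_pM2r (x := q%:R ^+ 2 + 1)); last by nra.
  by move: le; lra.
rewrite v6 // => le; rewrite -(ler_pM2r (x := q%:R ^+ 2 - q%:R + 1)); last by nra.
by move: le; lra.
Qed.
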